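(* For each pair of nonnegative integers $\alpha$ and $\beta$ there is a constant $K(\alpha,\beta)$, independent of $d$, such that for every $d\geq 1$ the number of combinatorial types of $d$-dimensional convex polytopes with no more than $d+1+\alpha$ vertices and no more than $d+1+\beta$ facets is at most $K(\alpha,\beta)$.
   Context: Two polytopes have the same combinatorial type if their face lattices are isomorphic. *)

(* Defs.v *)
From mathcomp Require Import all_boot all_order all_algebra.
From mathcomp Require Import boolp classical_sets functions cardinality reals.
From mathcomp Require Import convex.

Import Order.TTheory GRing.Theory Num.Theory.

Local Open Scope classical_set_scope.
Local Open Scope ring_scope.

Section Hulls.
Context {R : realType} {n : nat}.
Implicit Types A : set 'rV[R]_n.

Definition convex_hull A : set 'rV[R]_n := smallest (@convex_set R 'rV[R]_n) A.

Definition affine_set A : Prop :=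
  forall x y t, A x -> A y -> A (t *: x + (1 - t) *: y).

Definition affine_hull A : set 'rV[R]_n := smallest affine_set A.

(* The empty set is affine but not a translate of a subspace, so it has no
   dimension in this sense. *)
Definition has_dim A (d : nat) : Prop :=
  exists (x0 : 'rV[R]_n) (U : {vspace 'rV[R]_n}),
    \dim U = d /\ affine_hull A = [set x | x - x0 \in U].

End Hulls.

(* Polytopes of the same dimension may live in different ambient spaces. *)
Record polytope (R : realType) := Polytope {
  ambient : nat;
  body : set 'rV[R]_ambient;
  body_hull : exists2 V : set 'rV[R]_ambient, finite_set V & body = convex_hull V
}.

Arguments ambient {R} _.
Arguments body {R} _ _.

Section Faces.
Context {R : realType}.
Implicit Types P Q : polytope R.

(* The form c is allowed to vanish: b = 0 then gives P itself as a face, and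
   b = 1 gives the empty face. *)
Definition faces P : set (set 'rV[R]_(ambient P)) :=
  [set F | exists (c : 'cV[R]_(ambient P)) (b : R),
     (forall x, body P x -> (x *m c) 0 0 <= b) /\
     F = body P `&` [set x | (x *m c) 0 0 = b]].

Definition vertices P : set 'rV[R]_(ambient P) := [set v | faces P [set v]].

Definition facets P : set (set 'rV[R]_(ambient P)) :=
  [set F | faces P F /\ exists k, has_dim (body P) k.+1 /\ has_dim F k].

(* Isomorphism of face lattices: an order isomorphism for inclusion, which
   automatically preserves meets and joins. *)
Definition comb_equiv P Q : Prop :=
  exists2 f : set 'rV[R]_(ambient P) -> set 'rV[R]_(ambient Q),
    set_bij (faces P) (faces Q) f &
    forall F G, faces P F -> faces P G -> (F `<=` G <-> f F `<=` f G).

Definition comb_type P : set (polytope R) := [set Q | comb_equiv P Q].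

End Faces.

(* Main.v *)
Require Import Defs.
From mathcomp Require Import all_boot all_order all_algebra.
From mathcomp Require Import boolp classical_sets functions cardinality reals.
From mathcomp Require Import interval_inference convex.
From mathcomp Require Import zify ring.

(* Every vertex of a d-polytope lies on at least d facets and every facet has at
   least d vertices, so a vertex misses at most beta + 1 facets and a facet misses
   at most alpha + 1 vertices. Call two vertices neighbours if some facet misses
   both; neighbourhoods then have bounded size. Let star v be the smallest face
   containing all neighbours of v; all its vertices are within distance two of v.
   If the vertices of star v are affinely independent, some facet misses only v,
   i.e. the polytope is a pyramid with apex v. Otherwise star v carries an affine
   dependency. Disjointly supported dependencies are linearly independent, so at
   most alpha stars of non-apices are pairwise disjoint, and bounded degree bounds
   the number of non-apices by a constant. The face lattice is determined by the
   number of vertices and the traces of the faces on the non-apices. *)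

Set Implicit Arguments.
Unset Strict Implicit.
Unset Printing Implicit Defensive.

Import Order.TTheory GRing.Theory Num.Theory.

Local Open Scope ring_scope.

(** * Faces of a vector configuration *)

Lemma leq_card_bigcup (I T : finType) (P : pred I) (f : I -> {set T}) (k : nat) :
  (forall i, P i -> #|f i| <= k)%N -> (#|\bigcup_(i | P i) f i| <= #|P| * k)%N.
Proof.
move=> fk; rewrite -sum_nat_const.
apply: (@leq_trans (\sum_(i | P i) #|f i|)); last exact: leq_sum.
elim/big_rec2: _ => [|i s A _ IH]; first by rewrite cards0.
by rewrite (leq_trans (leq_card_setU _ _)) // leq_add2l.
Qed.

Section Configuration.
Context {F : realFieldType} {n m : nat}.
Variable X : 'M[F]_(n, m).
Implicit Types (A B C : {set 'I_n}) (c h : 'cV[F]_m) (i v w : 'I_n).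

Definition height c i : F := (X *m c) i 0.

(** For homogenised points a linear form on the rows is an affine form on the points, so an exposed
    set collects the indices of the points on a face. *)
Definition exposes c A :=
  (forall i, 0 <= height c i) /\ forall i, (i \in A) = (height c i == 0).

Definition exposed A := exists c, exposes c A.

Definition rowspan A : 'M[F]_m := (\sum_(i in A) <<row i X>>)%MS.

(** For homogenised points this is one more than the affine dimension, with value 0 at the empty
    set. *)
Definition rk A := \rank (rowspan A).

Lemma heightE c i : height c i = (row i X *m c) 0 0.
Proof. by rewrite -row_mul mxE. Qed.

Lemma heightDZ c h t i : height (c + t *: h) i = height c i + t * height h i.
Proof. by rewrite /height mulmxDr -scalemxAr !mxE. Qed.

Lemma heightN c i : height (- c) i = - height c i.
Proof. by rewrite /height mulmxN mxE. Qed.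

Lemma rowspan_sub A (p : nat) (M : 'M_(p, m)) :
  reflect (forall i, i \in A -> (row i X <= M)%MS) (rowspan A <= M)%MS.
Proof.
by apply: (iffP sumsmx_subP) => H i /H; rewrite genmxE.
Qed.

Lemma row_sub_rowspan A i : i \in A -> (row i X <= rowspan A)%MS.
Proof. by move=> iA; apply: (sumsmx_sup i) => //; rewrite genmxE. Qed.

Lemma rowspanS A B : A \subset B -> (rowspan A <= rowspan B)%MS.
Proof. by move=> /fintype.subsetP AB; apply/rowspan_sub => i /AB; apply: row_sub_rowspan. Qed.

Lemma rkS A B : A \subset B -> (rk A <= rk B)%N.
Proof. by move/rowspanS/mxrankS. Qed.

Lemma rkU A B : (rk (A :|: B) <= rk A + rk B)%N.
Proof.
apply: leq_trans (mxrank_adds_leqif _ _).1; apply/mxrankS/rowspan_sub => i.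
by rewrite inE => /orP[] /row_sub_rowspan H; apply: (submx_trans H);
  rewrite ?addsmxSl ?addsmxSr.
Qed.

Lemma rk_set1 i : (rk [set i] <= 1)%N.
Proof. by rewrite /rk /rowspan big_set1 genmxE rank_leq_row. Qed.

Lemma rk0 : rk finset.set0 = 0%N.
Proof. by rewrite /rk /rowspan big_set0 mxrank0. Qed.

Lemma rk_card A : (rk A <= #|A|)%N.
Proof.
rewrite -sum1_card /rk /rowspan; elim/big_rec2: _ => [|i k M _ IH].
  by rewrite mxrank0.
apply: (leq_trans (mxrank_adds_leqif _ _).1).
by rewrite leq_add // genmxE rank_leq_row.
Qed.

Lemma rk_bigcup (I : finType) (f : I -> {set 'I_n}) (P : pred I) :
  (rk (\bigcup_(j | P j) f j) <= \sum_(j | P j) rk (f j))%N.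
Proof.
elim/big_rec2: _ => [|j s A _ IH]; first by rewrite rk0.
by rewrite (leq_trans (rkU _ _)) // leq_add2l.
Qed.

Lemma rowspan_height0 A c w : (forall i, i \in A -> height c i = 0) ->
  (row w X <= rowspan A)%MS -> height c w = 0.
Proof.
move=> cA /submxP[D wD].
suff A0 : rowspan A *m c = 0 by rewrite heightE wD -mulmxA A0 mulmx0 mxE.
apply/eqP; rewrite -sub_kermx; apply/rowspan_sub => i iA; rewrite sub_kermx.
by apply/eqP/matrixP => a b; rewrite !ord1 -heightE cA // mxE.
Qed.

Lemma separating_functional A w : ~~ (row w X <= rowspan A)%MS ->
  exists2 h, forall i, i \in A -> height h i = 0 & height h w != 0.
Proof.
rewrite submxE => /rV0Pn[j hj]; exists (col j (cokermx (rowspan A))); last first.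
  by rewrite heightE colE mulmxA -colE mxE.
move=> i /row_sub_rowspan; rewrite submxE => /eqP Hi.
by rewrite heightE colE mulmxA Hi mul0mx mxE.
Qed.

Lemma separating_functional_gt0 A w : ~~ (row w X <= rowspan A)%MS ->
  exists2 h, forall i, i \in A -> height h i = 0 & 0 < height h w.
Proof.
case/separating_functional => h hA; rewrite neq_lt => /orP[] hw; last by exists h.
exists (- h) => [i /hA hi|]; rewrite heightN; first by rewrite hi oppr0.
by rewrite oppr_gt0.
Qed.

(* [h] only has to be nonnegative on [B]: adding a large multiple of the
   functional exposing [B] repairs the remaining signs. *)
Lemma exposed_subface B h : exposed B -> (forall i, i \in B -> 0 <= height h i) ->
  exposed [set i in B | height h i == 0].
Proof.
(* [M] strictly exceeds every [- (height h i / height c i)], so [h + M *: c] is positive off [B]. *)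
move=> [c [c0 cB]] hB; pose M := \sum_i `|height h i / height c i| + 1.
have HM i : i \notin B -> 0 < height h i + M * height c i.
  rewrite cB => ci; have c_gt0 : 0 < height c i by rewrite lt_neqAle eq_sym ci c0.
  suff : - (height h i / height c i) < M.
    by rewrite -mulNr ltr_pdivrMr // -subr_gt0 opprK addrC.
  rewrite /M (bigD1 i) //= -addrA; apply: (le_lt_trans (ler_norm _)).
  by rewrite normrN ltrDl ltr_wpDl // sumr_ge0.
exists (h + M *: c); split=> i; rewrite heightDZ.
  case: (boolP (i \in B)) => iB; last exact/ltW/HM.
  by have := iB; rewrite cB => /eqP->; rewrite mulr0 addr0 hB.
rewrite inE; case: (boolP (i \in B)) => iB /=.
  by have := iB; rewrite cB => /eqP->; rewrite mulr0 addr0.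
by rewrite gt_eqF // HM.
Qed.

Lemma exposedT : exposed [set: 'I_n].
Proof.
exists 0; split=> i; first by rewrite /height mulmx0 mxE.
by rewrite inE /height mulmx0 mxE eqxx.
Qed.

Lemma exposedI A B : exposed A -> exposed B -> exposed (A :&: B).
Proof.
move=> [c [c0 cA]] eB; have := exposed_subface eB (fun i _ => c0 i).
by congr exposed; apply/setP => i; rewrite !inE -cA andbC.
Qed.

Lemma exposed_bigcap (I : finType) (f : I -> {set 'I_n}) (P : pred I) :
  (forall j, P j -> exposed (f j)) -> exposed (\bigcap_(j | P j) f j).
Proof.
by move=> H; elim/big_ind: _ => //; [exact: exposedT | exact: exposedI].
Qed.

(** The form exposing [[set~ i]] vanishes at every index but [i], so subtracting a multiple of it
    brings the value at [i] to 0 and changes no other value. *)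
Lemma exposed_setU1 A i : exposed [set~ i] -> exposed A -> exposed (i |: A).
Proof.
move=> [e [e0 ei]] [c [c0 cA]]; have hi : height e i != 0 by rewrite -ei !inE eqxx.
exists (c + (- (height c i / height e i)) *: e).
have hE j : height (c + (- (height c i / height e i)) *: e) j =
    if j == i then 0 else height c j.
  rewrite heightDZ; have [->|ji] := eqVneq j i; first by rewrite mulNr divfK ?subrr.
  suff /eqP-> : height e j == 0 by rewrite mulr0 addr0.
  by rewrite -ei !inE.
split=> j; rewrite hE; first by case: ifP.
by rewrite !inE cA; case: eqP => //=; rewrite eqxx.
Qed.

(* Removing all apices from the vertices leaves the base of an iterated
   pyramid, and only the trace of a face on that base matters. *)
Lemma exposed_setU_apices A B : (forall i, i \in B -> exposed [set~ i]) ->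
  exposed (A :|: B) <-> exposed A.
Proof.
move=> eB; split=> [eAB|eA].
  (* Each element of [B :\: A] is cut away by the exposed set that misses it alone. *)
  have -> : A = (A :|: B) :&: \bigcap_(i in B :\: A) [set~ i].
    apply/setP => i; rewrite !inE; apply/idP/andP => [iA|[/orP[//|iB] /bigcapP iC]].
      split; first by rewrite iA.
      by apply/bigcapP => j; rewrite !inE => /andP[jA _]; apply: contraNneq jA => <-.
    by apply: contraT => iA; have := iC i; rewrite !inE iA iB eqxx => /(_ isT).
  by apply: exposedI => //; apply: exposed_bigcap => i; rewrite inE => /andP[_ /eB].
have -> : A :|: B = foldr (fun i S => i |: S) A (enum B).
  apply/setP => j; rewrite inE -(mem_enum (mem B)).
  by elim: (enum B) => [|i s IH] /=; rewrite ?orbF // !inE -IH orbCA.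
have : forall i, i \in enum B -> exposed [set~ i] by move=> i; rewrite mem_enum => /eB.
elim: (enum B) => [//|i s IH] es /=; apply: exposed_setU1; first by apply: es; rewrite inE eqxx.
by apply: IH => j js; apply: es; rewrite inE js orbT.
Qed.

(** A form exposing [A] vanishes on the span of [A] but not at [w]. *)
Lemma exposed_rk_lt A B w : exposed A -> A \subset B -> w \in B -> w \notin A ->
  (rk A < rk B)%N.
Proof.
move=> [c [c0 cA]] AB wB wA; apply/rank_ltmx/andP; split; first exact: rowspanS.
apply: contra wA => BA; rewrite cA; apply/eqP/(@rowspan_height0 A) => [i|].
  by rewrite cA => /eqP.
exact: submx_trans (row_sub_rowspan wB) BA.
Qed.

(* Among the faces between [A] and [B] that avoid [w], one with the most
   elements has corank one in [B]: otherwise its functional could be rotated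
   about it and [w] until the zero set grows. *)
Lemma exposed_corank1 A B w : exposed A -> exposed B -> A \subset B ->
  w \in B -> w \notin A ->
  exists C, [/\ exposed C, A \subset C, C \subset B, w \notin C
               & (rk C).+1 = rk B].
Proof.
move=> eA eB AB wB wA.
pose P C := `[< exposed C >] && [&& A \subset C, C \subset B & w \notin C].
have PA : P A by apply/and4P; split => //; exact/asboolP.
have [C /and4P[/asboolP eC AC CB wC] Cmax] :=
  @arg_maxnP _ A P (fun C => #|C|) PA.
exists C; split => //; apply/eqP; rewrite eqn_leq; apply/andP; split.
  exact: exposed_rk_lt wB wC.
rewrite leqNgt; apply/negP => rkC.
(* With corank at least two, [C] and [w] together do not span [B], so some form vanishes on both but
   not on all of [B]. *)
have [u uB uC] : exists2 u, u \in B & ~~ (row u X <= rowspan (w |: C))%MS.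
  apply/exists_inP; rewrite -negb_forall_in; apply: contraL rkC => /forall_inP H.
  rewrite -leqNgt; apply: leq_trans (mxrankS _) _; last first.
    by apply: leq_trans (rkU [set w] C) _; rewrite -add1n leq_add2r rk_set1.
  exact/rowspan_sub.
have [h0 h0C h0u] := separating_functional_gt0 uC.
pose h := - h0.
have hC i : i \in w |: C -> height h i = 0 by move=> /h0C; rewrite heightN => ->; rewrite oppr0.
have hu : height h u < 0 by rewrite heightN oppr_lt0.
have [c [c0 cC]] := eC.
pose p i := (i \in B) && (height h i < 0).
have uP : p u by rewrite /p uB.
(* [f i] is the [t] at which [c + t *: h] vanishes at [i]. The least one over the rows of [B] where
   [h] is negative keeps the form nonnegative on [B] and adds the zero [i0]. *)
pose f i := - (height c i / height h i).
have [i0 /andP[i0B hi0] i0min] := arg_minP f uP.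
have i0C : i0 \notin C.
  by apply/negP => i0C; move: hi0; rewrite hC ?inE ?i0C ?orbT // ltxx.
have t_ge i : i \in B -> 0 <= height (c + f i0 *: h) i.
  move=> iB; rewrite heightDZ; case: (ltrP (height h i) 0) => hi.
    have fi : f i * height h i = - height c i by rewrite mulNr divfK ?lt_eqF.
    have := i0min i; rewrite /p iB hi => /(_ isT).
    by rewrite -(ler_nM2r hi) fi -subr_ge0 opprK addrC.
  rewrite addr_ge0 // mulr_ge0 // /f oppr_ge0 mulr_ge0_le0 // invr_le0 ltW //.
have eC' := exposed_subface eB t_ge.
set C' := [set i in B | _] in eC'.
have CC' : C \subset C'.
  apply/fintype.subsetP => i iC; rewrite inE (fintype.subsetP CB) //= heightDZ hC ?inE ?iC ?orbT //.
  by rewrite mulr0 addr0 -cC.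
have i0C' : i0 \in C'.
  by rewrite inE i0B heightDZ /f mulNr divfK ?subrr ?eqxx ?lt_eqF.
have := Cmax C'; rewrite /P (fintype.subset_trans AC CC').
have -> : C' \subset B by apply/fintype.subsetP => i; rewrite inE => /andP[].
have -> : w \notin C'.
  by rewrite inE wB heightDZ hC ?inE ?eqxx // mulr0 addr0 -cC.
rewrite !andbT => /(_ (asboolT eC')); rewrite /geq /= leqNgt => /negP; apply.
apply: proper_card; apply/properP; split => //; by exists i0.
Qed.

Definition facet_sets : {set {set 'I_n}} :=
  [set A | `[< exposed A >] & (rk A).+1 == rk finset.setT].

Lemma facet_exposed A : A \in facet_sets -> exposed A.
Proof. by rewrite inE => /andP[/asboolP]. Qed.

Lemma facet_avoiding A w : exposed A -> w \notin A ->
  exists G, [/\ G \in facet_sets, A \subset G & w \notin G].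
Proof.
move=> eA wA; have [G [eG AG _ wG rkG]] :=
  exposed_corank1 eA exposedT (finset.subsetT A) (finset.in_setT w) wA.
exists G; split => //; rewrite inE rkG eqxx andbT; exact/asboolP.
Qed.

(** Descend from [B] to [A] one rank at a time. If [C] has corank one in [B] and misses [w], then
    some facet through [C] misses [w] as well, so [C] lies on at least one facet more than [B]. *)
Lemma card_facets_over A B : exposed A -> exposed B -> A \subset B ->
  (#|[set G in facet_sets | B \subset G]| + (rk B - rk A)
    <= #|[set G in facet_sets | A \subset G]|)%N.
Proof.
move=> eA; have [k] := ubnP (rk B - rk A); elim: k B => // k IH B.
rewrite ltnS => leBk eB AB.
have [/eqP -> | neAB] := boolP (A == B); first by rewrite subnn addn0.
have /properP[_ [w wB wA]] : A \proper B by rewrite finset.properEneq neAB.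
have [C [eC AC CB wC rkC]] := exposed_corank1 eA eB AB wB wA.
have rkAC := rkS AC.
have [G [fG CG wG]] := facet_avoiding eC wC.
have/IH : (rk C - rk A < k)%N by apply: leq_trans leBk; rewrite -rkC subSn.
move=> /(_ eC AC); apply: leq_trans; rewrite -rkC subSn // addnS -addSn leq_add2r.
apply: proper_card; apply/properP; split.
  apply/fintype.subsetP => H; rewrite !inE => /andP[-> BH] /=.
  exact: fintype.subset_trans BH.
exists G; rewrite inE fG //=.
by apply: contra wG => /fintype.subsetP; apply.
Qed.


(** * Configurations whose numbers of rows and facets barely exceed the rank *)

Section Excess.
Variables a b : nat.
Hypothesis exposed0 : exposed finset.set0.
Hypothesis exposed1 : forall i, exposed [set i].
Hypothesis rows_le : (n <= rk finset.setT + a)%N.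
Hypothesis facets_le : (#|facet_sets| <= rk finset.setT + b)%N.

(** Bounds a neighbourhood: at most [b.+1] facets miss a given index, and each of them misses at
    most [a.+1] indices. *)
Let D := (b.+1 * a.+1)%N.

(** Going from the whole set down to [[set i]], [card_facets_over] yields at least [rk setT - 1]
    facets through [i]. *)
Lemma card_facets_missing i : (#|[set G in facet_sets | i \notin G]| <= b.+1)%N.
Proof.
have := card_facets_over (exposed1 i) exposedT (finset.subsetT _).
have -> : [set G : {set _} in facet_sets | [set i] \subset G] = [set G in facet_sets | i \in G].
  by apply/setP => G; rewrite !inE finset.sub1set.
pose over := [set G : {set 'I_n} | i \in G]; have := cardsID over facet_sets.
have -> : facet_sets :&: over = [set G in facet_sets | i \in G].
  by apply/setP => G; rewrite !inE.
have -> : facet_sets :\: over = [set G in facet_sets | i \notin G].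
  by apply/setP => G; rewrite !inE andbC.
move=> split_card over_card.
have arith p q f r s z : (p + q = f -> z + (r - s) <= p -> s <= 1 -> f <= r + b ->
    q <= b.+1)%N by lia.
exact: arith split_card over_card (rk_set1 i) facets_le.
Qed.

Lemma card_facetC G : G \in facet_sets -> (#|~: G| <= a.+1)%N.
Proof.
rewrite inE => /andP[_ /eqP rkG]; have := cardsC G; rewrite card_ord.
by move: (rk_card G) rows_le; lia.
Qed.

Definition nbr v := (\bigcup_(G in facet_sets | v \notin G) ~: G)%SET.

Lemma nbrP v w :
  reflect (exists G, [/\ G \in facet_sets, v \notin G & w \notin G]) (w \in nbr v).
Proof.
apply: (iffP bigcupP) => [[G /andP[fG vG]]|[G [fG vG wG]]].
  by rewrite inE => wG; exists G.
by exists G; rewrite ?fG ?inE.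
Qed.

Lemma nbr_sym v w : (w \in nbr v) = (v \in nbr w).
Proof. by apply/nbrP/nbrP => -[G [? ? ?]]; exists G. Qed.

Lemma nbr_refl v : v \in nbr v.
Proof.
apply/nbrP; have [|G [fG _ vG]] := @facet_avoiding _ v exposed0.
  by rewrite inE.
by exists G.
Qed.

Lemma card_nbr v : (#|nbr v| <= D)%N.
Proof.
apply: leq_trans (leq_card_bigcup (k := a.+1) _) _ => [G /andP[/card_facetC //]|].
by rewrite leq_mul2r -cardsE; apply/orP; right; apply: card_facets_missing.
Qed.

Definition nbrs A := (\bigcup_(v in A) nbr v)%SET.

Lemma card_nbrs A : (#|nbrs A| <= #|A| * D)%N.
Proof. by apply: leq_card_bigcup => v _; exact: card_nbr. Qed.

Definition star v := (\bigcap_(G in facet_sets | nbr v \subset G) G)%SET.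

Lemma exposed_star v : exposed (star v).
Proof. by apply: exposed_bigcap => G /andP[/facet_exposed]. Qed.

Lemma nbr_sub_star v : nbr v \subset star v.
Proof. by apply/bigcapsP => G /andP[]. Qed.

(** A facet missing an element [k] of the star cannot contain all of [nbr v]. It therefore misses
    some [u] in [nbr v], and [k] is a neighbour of that [u]. *)
Lemma star_sub_nbrs v : star v \subset nbrs (nbr v).
Proof.
apply/fintype.subsetP => k /bigcapP kv; have /nbrP[G [fG _ kG]] := nbr_refl k.
have : ~~ (nbr v \subset G) by apply: contra kG => vG; apply: kv; rewrite fG.
case/subsetPn => u uv uG; apply/bigcupP; exists u => //.
by apply/nbrP; exists G.
Qed.

(* If the rows of the face [star v] are independent, it is a simplex, so
   deleting [v] from it leaves a face; a facet through that face but not through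
   [v] can only miss neighbours of [v], hence misses [v] alone. *)
Lemma apex_of_independent_star v : rk (star v) = #|star v| -> exposed [set~ v].
Proof.
have vS : v \in star v := fintype.subsetP (nbr_sub_star v) _ (nbr_refl v).
move=> rkS; have : ~~ (row v X <= rowspan (star v :\ v))%MS.
  apply/negP => vD; suff : (rk (star v) <= rk (star v :\ v))%N.
    rewrite rkS => /leq_trans/(_ (rk_card _)).
    by rewrite (cardsD1 v (star v)) vS ltnn.
  apply/mxrankS/rowspan_sub => i iS; have [-> //|iv] := eqVneq i v.
  by apply: row_sub_rowspan; rewrite !inE iv.
case/separating_functional_gt0 => h hS hv.
have h0 i : i \in star v -> 0 <= height h i.
  move=> iS; have [-> |iv] := eqVneq i v; first exact: ltW.
  by rewrite hS // !inE iv.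
have := exposed_subface (exposed_star v) h0; set A := [set i in _ | _] => eA.
have vA : v \notin A by rewrite inE (gt_eqF hv) andbF.
have [G [fG AG vG]] := facet_avoiding eA vA.
have -> : [set~ v] = G.
  apply/setP => k; rewrite !inE; have [-> |kv] := eqVneq k v.
    by rewrite (negbTE vG).
  apply/esym/negPn/negP => kG; have : k \in A; last by move/(fintype.subsetP AG); apply/negP.
  have kS : k \in star v.
    by apply: (fintype.subsetP (nbr_sub_star v)); apply/nbrP; exists G.
  by rewrite inE kS hS ?eqxx // !inE kv.
exact: facet_exposed.
Qed.

(** Each dependent set has cardinality exceeding its rank by at least one. These excesses add up
    over disjoint sets, while the excess of the whole configuration is at most [a]. *)
Lemma disjoint_dependent_le (S : {set 'I_n}) (f : 'I_n -> {set 'I_n}) :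
  (forall u v, u \in S -> v \in S -> u != v -> [disjoint f u & f v]) ->
  (forall v, v \in S -> (rk (f v) < #|f v|)%N) -> (#|S| <= a)%N.
Proof.
(* Extending [f] by the empty set makes the family disjoint over all indices. *)
move=> fdis fdep; pose g v := if v \in S then f v else finset.set0.
have gdis u v : u != v -> [disjoint g u & g v].
  rewrite /g => uv; case: ifP => uS; last by rewrite finset.disjoints_subset finset.sub0set.
  case: ifP => vS; first exact: fdis.
  by rewrite disjoint_sym finset.disjoints_subset finset.sub0set.
have cardU : #|(\bigcup_v g v)%SET| = \sum_(v in S) #|f v|.
  rewrite -sum1_card partition_disjoint_bigcup // big_mkcond /= [RHS]big_mkcond.
  apply: eq_bigr => v _; rewrite sum1_card /g; case: ifP => // _; exact: cards0.
have rkU' : (rk (\bigcup_v g v)%SET + #|S| <= #|(\bigcup_v g v)%SET|)%N.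
  rewrite cardU -[#|S|]sum1_card.
  apply: (@leq_trans (\sum_(v in S) rk (f v) + \sum_(v in S) 1)%N).
    rewrite leq_add2r (leq_trans (rk_bigcup _ _)) // [leqRHS]big_mkcond /=.
    by apply: leq_sum => v _; rewrite /g; case: ifP => // _; rewrite rk0.
  by rewrite -big_split /=; apply: leq_sum => v vS; rewrite addn1 fdep.
have := cardsC (\bigcup_v g v)%SET; have := rk_card (~: (\bigcup_v g v)%SET).
have := rkU (\bigcup_v g v)%SET (~: (\bigcup_v g v)%SET).
rewrite finset.setUCr card_ord; move: rkU' rows_le; lia.
Qed.

(** By maximality of a family [S] of non-apices with disjoint stars, the star of every non-apex
    meets that of a member of [S]. Stars reach distance two, so four steps from [S] suffice, one
    factor [D] each. *)
Lemma card_non_apex :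
  (#|[set v | ~~ `[< exposed [set~ v] >]]| <= a * D * D * D * D)%N.
Proof.
set U := [set v | _].
have Udep v : v \in U -> (rk (star v) < #|star v|)%N.
  rewrite inE => /asboolPn vU; rewrite ltn_neqAle rk_card andbT.
  by apply/eqP => /apex_of_independent_star.
pose dis (S : {set 'I_n}) :=
  [forall u in S, forall v in S, (u != v) ==> [disjoint star u & star v]].
pose P (S : {set 'I_n}) := (S \subset U) && dis S.
have P0 : P finset.set0.
  by rewrite /P finset.sub0set; apply/forall_inP => u; rewrite inE.
have [S /andP[SU Sdis] Smax] := @arg_maxnP _ finset.set0 P (fun C => #|C|) P0.
have disS u v : u \in S -> v \in S -> u != v -> [disjoint star u & star v].
  by move=> uS vS; move/forall_inP: Sdis => /(_ u uS)/forall_inP/(_ v vS)/implyP.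
have Sa : (#|S| <= a)%N.
  by apply: disjoint_dependent_le disS _ => v vS; apply/Udep/(fintype.subsetP SU).
have meets u : u \in U -> exists2 s, s \in S & ~~ [disjoint star s & star u].
  move=> uU; have uu : ~~ [disjoint star u & star u].
    apply/pred0Pn; exists u => /=.
    by rewrite (fintype.subsetP (nbr_sub_star u) _ (nbr_refl u)).
  have [uS | uS] := boolP (u \in S); first by exists u.
  apply/exists_inP; rewrite -negb_forall_in; apply/negP => /forall_inP sdis.
  have : P (u |: S).
    rewrite /P finset.subUset finset.sub1set uU SU /=.
    apply/forall_inP => x xS; apply/forall_inP => y yS; apply/implyP.
    move: xS yS; rewrite !inE => /orP[/eqP->|xS] /orP[/eqP->|yS].
    - by rewrite eqxx.
    - by move=> _; rewrite disjoint_sym sdis.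
    - by move=> _; rewrite sdis.
    - exact: disS.
  by move/Smax; rewrite /geq /= cardsU1 uS add1n ltnn.
(* A common element [k] of the stars of [s] and [u] gives a path [s], [x], [k], [y], [u] of
   successive neighbours. *)
have UN : U \subset nbrs (nbrs (nbrs (nbrs S))).
  apply/fintype.subsetP => u /meets[s sS] /pred0Pn[k /= /andP[ks ku]].
  have /bigcupP[x xs kx] := fintype.subsetP (star_sub_nbrs s) _ ks.
  have /bigcupP[y yu ky] := fintype.subsetP (star_sub_nbrs u) _ ku.
  apply/bigcupP; exists y; last by rewrite nbr_sym.
  apply/bigcupP; exists k; last by rewrite nbr_sym.
  by apply/bigcupP; exists x => //; apply/bigcupP; exists s.
apply: leq_trans (subset_leq_card UN) _.
do 4 (apply: leq_trans (card_nbrs _) _; rewrite leq_mul2r; apply/orP; right).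
exact: Sa.
Qed.

End Excess.

End Configuration.

(** * Convex hulls of finite families *)

(* Bartl's induction: when the last inequality is not redundant, a point [z]
   violating the conclusion satisfies [a k z < 0], and projecting along [z] onto
   the kernel of [a k] removes that inequality. *)
Lemma farkas {F : realFieldType} {p : nat} (k : nat) (a : nat -> 'rV[F]_p) (b : 'rV[F]_p) :
  (forall c : 'cV_p, (forall i, (i < k)%N -> 0 <= (a i *m c) 0 0) ->
     0 <= (b *m c) 0 0) ->
  exists2 l : nat -> F, forall i, 0 <= l i & b = \sum_(i < k) l i *: a i.
Proof.
elim: k a b => [|k IH] a b ab.
  exists (fun=> 0) => //; rewrite big_ord0; apply/rowP => j.
  (* With no inequalities left, testing both signs of each basis vector forces [b] to be 0. *)
  have pos s : 0 <= (b *m (s *: delta_mx j (0 : 'I_1))) 0 0 by apply: ab.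
  have := pos 1; have := pos (-1).
  rewrite -!scalemxAr -colE !mxE mulN1r oppr_ge0 mul1r => b1 b2.
  by apply/le_anti/andP.
have [|] := pselect (forall c : 'cV_p,
    (forall i, (i < k)%N -> 0 <= (a i *m c) 0 0) -> 0 <= (b *m c) 0 0).
  move=> /IH[l l0 bl]; exists (fun i => if (i < k)%N then l i else 0).
    by move=> i; case: ifP.
  rewrite big_ord_recr /= ltnn scale0r addr0 bl.
  by apply: eq_bigr => i _; rewrite ltn_ord.
move/existsNP => [z /not_implyP[az /negP]]; rewrite -ltNge => bz.
have akz : (a k *m z) 0 0 < 0.
  rewrite ltNge; apply/negP => akz; move: bz; rewrite ltNge ab // => i.
  by rewrite ltnS leq_eqVlt => /orP[/eqP->|/az].
set e := (a k *m z) 0 0 in akz.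
(* This is the transpose of the projection of columns along [z] onto the kernel of [a k]; it sends
   [a k] to 0. *)
pose proj (u : 'rV[F]_p) := u - ((u *m z) 0 0 / e) *: a k.
have projE u c : (proj u *m c) 0 0 = (u *m (c - ((a k *m c) 0 0 / e) *: z)) 0 0.
  by rewrite /proj mulmxBl mulmxBr -scalemxAl -scalemxAr !mxE; ring.
have [|l l0 bl] := IH (fun i => proj (a i)) (proj b).
  move=> c ac; rewrite projE; apply: ab => i.
  rewrite ltnS leq_eqVlt => /orP[/eqP->|/ac]; last by rewrite projE.
  by rewrite -projE /proj divff ?lt_eqF // scale1r subrr mul0mx mxE.
(* The coefficient of [a k] left over when the projection is undone. It is nonnegative because [b]
   and [a k] are negative at [z] and the other [a i] are not. *)
pose t := ((b *m z) 0 0 - \sum_(i < k) l i * (a i *m z) 0 0) / e.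
exists (fun i => if (i < k)%N then l i else t).
  move=> i; case: ifP => // _; rewrite /t mulr_le0 ?invr_le0 ?(ltW akz) //.
  rewrite subr_le0 (le_trans (ltW bz)) // sumr_ge0 // => j _.
  by rewrite mulr_ge0 // az.
rewrite big_ord_recr /= ltnn.
under eq_bigr do rewrite ltn_ord.
have -> : b = proj b + ((b *m z) 0 0 / e) *: a k by rewrite subrK.
rewrite bl /t mulrBl scalerBl.
have -> : \sum_(i < k) l i *: proj (a i) =
    \sum_(i < k) l i *: a i - ((\sum_(i < k) l i * (a i *m z) 0 0) / e) *: a k.
  rewrite mulr_suml scaler_suml -sumrB; apply: eq_bigr => i _.
  by rewrite /proj scalerBr scalerA mulrA.
by rewrite -addrA; congr (_ + _); rewrite addrC.
Qed.

Section ConvexHull.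
Local Open Scope classical_set_scope.
Context {R : realType} {n m : nat}.
Variable x : 'I_n -> 'rV[R]_m.
Implicit Types (A B : {set 'I_n}) (y : 'rV[R]_m) (l : 'I_n -> R).

(* The affine inequality [y *m c <= b] becomes linear on the homogenised rows
   [(1, y)]. *)
Definition hom_rows : 'M[R]_(n, 1 + m) := row_mx (const_mx 1) (\matrix_i x i).

Lemma row_hom_rows i : row i hom_rows = row_mx 1 (x i).
Proof.
rewrite row_row_mx rowK; congr row_mx; apply/rowP => j; rewrite !mxE.
by rewrite ord1 eqxx.
Qed.

Lemma height_hom_rows (c : 'cV[R]_(1 + m)) i :
  height hom_rows c i = c 0 0 + (x i *m dsubmx c) 0 0.
Proof.
rewrite heightE row_hom_rows -{1}[c]vsubmxK mul_row_col mul1mx mxE.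
by congr (_ + _); rewrite !mxE; congr (c _ _); apply/val_inj.
Qed.

Definition weights A l := [/\ forall i, 0 <= l i, forall i, i \notin A -> l i = 0
                            & \sum_i l i = 1].

Definition hull A : set 'rV[R]_m :=
  [set y | exists2 l, weights A l & y = \sum_i l i *: x i].

Lemma weightsS A B l : A \subset B -> weights A l -> weights B l.
Proof.
move=> /fintype.subsetP AB [l0 lA l1]; split=> // i iB; apply: lA.
by apply: contra iB => /AB.
Qed.

Lemma hull_mem A i : i \in A -> hull A (x i).
Proof.
move=> iA; exists (fun j => (j == i)%:R).
  split=> [j||]; first exact: ler0n.
    by move=> j jA; case: eqVneq => // ji; rewrite ji iA in jA.
  by rewrite (bigD1 i) //= eqxx big1 ?addr0 // => j /negbTE->.
by rewrite (bigD1 i) //= eqxx scale1r big1 ?addr0 // => j /negbTE->; rewrite scale0r.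
Qed.

Lemma convex_setP (M : lmodType R) (S : set M) : convex_set S <->
  forall (y z : M) (t : R), 0 <= t -> t <= 1 -> S y -> S z -> S (t *: y + (1 - t) *: z).
Proof.
split=> [cS y z t t0 t1 Sy Sz|cS y z t /set_mem Sy /set_mem Sz].
  have := cS y z (Itv01 t0 t1); rewrite !inE; exact.
by apply/mem_set; apply: cS.
Qed.

Lemma hull_convex A : convex_set (hull A).
Proof.
apply/convex_setP => _ _ t t0 t1 [l [l0 lA l1] ->] [k [k0 kA k1] ->].
have t1' : 0 <= 1 - t by rewrite subr_ge0.
exists (fun i => t * l i + (1 - t) * k i).
  split=> [i|i iA|]; first by rewrite addr_ge0 ?mulr_ge0.
    by rewrite lA // kA // !mulr0 addr0.
  by rewrite big_split -!mulr_sumr l1 k1 /= !mulr1 addrC subrK.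
rewrite !scaler_sumr -big_split; apply: eq_bigr => i _.
by rewrite /= !scalerA -scalerDl.
Qed.

Lemma convex_hullE A : convex_hull (x @` [set` A]) = hull A.
Proof.
apply/seteqP; split; last first.
  move=> _ [l [l0 lA l1] ->] S [/convex_setP cS xS].
  have SA i : i \in A -> S (x i) by move=> iA; apply: xS; exists i.
  (* The induction runs over partial sums normalised to total weight 1; positivity of the weight
     keeps the inverse meaningful. *)
  suff : forall s : seq 'I_n, 0 < \sum_(i <- s) l i ->
      S ((\sum_(i <- s) l i)^-1 *: \sum_(i <- s) l i *: x i).
    by move=> /(_ (index_enum _)); rewrite l1 invr1 scale1r; apply.
  elim=> [|i s IH]; first by rewrite big_nil ltxx.
  rewrite !big_cons; set t := \sum_(_ <- _) _ in IH *; set w := \sum_(_ <- _) _ in IH *.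
  have : 0 <= t by apply: sumr_ge0.
  rewrite le_eqVlt => /predU1P[t0|t_gt0].
    have -> : w = 0.
      rewrite /w big1_seq // => j /andP[_ js].
      have /eqP : t = 0 by [].
      rewrite psumr_eq0 // => /allP/(_ j js) /= /eqP->; exact: scale0r.
    rewrite -t0 !addr0 => li; rewrite scalerA mulVf ?scale1r ?gt_eqF //.
    by apply: SA; apply: contraTT li => /lA->; rewrite ltxx.
  move=> lit; have [iA|/lA li] := boolP (i \in A); last first.
    by rewrite li scale0r !add0r; apply: IH.
  have -> : (l i + t)^-1 *: (l i *: x i + w) =
      (l i / (l i + t)) *: x i + (1 - l i / (l i + t)) *: (t^-1 *: w).
    rewrite scalerDr !scalerA; congr (_ *: _ + _ *: _); first by rewrite mulrC.
    by field; rewrite !gt_eqF.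
  apply: cS; [exact: divr_ge0 (ltW _) | | exact: SA | exact: IH].
  by rewrite ler_pdivrMr // mul1r lerDl ltW.
by apply: smallest_sub => [|_ [i iA <-]]; [exact: hull_convex | exact: hull_mem].
Qed.

(** Farkas for the homogenised rows: if no form separates, then [row_mx 1 y] lies in the cone of the
    rows of [A], and the leading coordinate forces the coefficients to sum to 1. *)
Lemma hull_separation A y : ~ hull A y -> exists2 c : 'cV[R]_(1 + m),
  forall i, i \in A -> 0 <= height hom_rows c i & c 0 0 + (y *m dsubmx c) 0 0 < 0.
Proof.
move=> Ay; apply: contrapT => sep; apply: Ay.
(* Indices outside [A] contribute the zero row, which imposes no inequality; their coefficients are
   reset to 0 below. *)
pose g (k : nat) := if insub k is Some i then
  if i \in A then row i hom_rows else 0 else (0 : 'rV[R]_(1 + m)).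
have gE (i : 'I_n) : g i = if i \in A then row i hom_rows else 0.
  by rewrite /g valK.
have [|l l0 yl] := @farkas _ _ n g (row_mx 1 y).
  move=> c cg; rewrite leNgt; apply/negP => cy; apply: sep; exists c.
    by move=> i iA; have := cg i (ltn_ord i); rewrite gE iA heightE.
  move: cy; rewrite -{1}[c]vsubmxK mul_row_col mul1mx mxE; congr (_ + _ < _).
  by rewrite !mxE; congr (c _ _); apply/val_inj.
have {}yl : row_mx 1 y = \sum_(i < n) (l i *+ (i \in A)) *: row_mx 1 (x i).
  rewrite yl; apply: eq_bigr => i _; rewrite gE row_hom_rows.
  by case: ifP; rewrite ?scale0r ?scaler0.
exists (fun i : 'I_n => l i *+ (i \in A)).
  split=> [i|i /negbTE->//|]; first exact: mulrn_wge0.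
  have /(congr1 (fun M : 'rV_(1 + m) => lsubmx M 0 0)) := yl.
  rewrite row_mxKl linear_sum summxE mxE eqxx => h1; rewrite -[RHS]/(true%:R) h1; apply: eq_bigr => i _.
  by rewrite linearZ /= row_mxKl !mxE eqxx mulr1.
have /(congr1 rsubmx) := yl.
rewrite row_mxKr linear_sum => ->; apply: eq_bigr => i _.
by rewrite linearZ /= row_mxKr.
Qed.

End ConvexHull.

Local Open Scope classical_set_scope.

(** * Dimension of a hull as a matrix rank *)

Section Dimension.
Context {R : realType}.

Lemma has_dim_uniq {n : nat} (S : set 'rV[R]_n) (k l : nat) :
  has_dim S k -> has_dim S l -> k = l.
Proof.
have le : forall (x y : 'rV[R]_n) (U V : {vspace 'rV[R]_n}),
    [set z | z - x \in U] = [set z | z - y \in V] -> (\dim U <= \dim V)%N.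
  move=> x y U V UV; apply: dimvS; apply/subvP => u uU.
  have inV z : z - x \in U -> z - y \in V.
    by move=> zU; have : [set z | z - x \in U] z by []; rewrite UV.
  have xV : x - y \in V by apply: inV; rewrite subrr mem0v.
  have : u + x - y \in V by apply: inV; rewrite addrK.
  by rewrite -addrA => uV; rewrite -[u](addrK (x - y)) memvB.
move=> [x [U [<- SU]]] [y [V [<- SV]]].
apply/eqP; rewrite eqn_leq (le x y) ?(le y x) //; first by rewrite -SU -SV.
by rewrite -SV -SU.
Qed.

Lemma has_dim_nonempty {n : nat} (S : set 'rV[R]_n) (k : nat) : has_dim S k -> S !=set0.
Proof.
move=> [x [U [_ SU]]]; apply/set0P/negP => /eqP S0.
have : affine_hull S x by rewrite SU /= subrr mem0v.
by move/(_ set0); apply; split; rewrite ?S0.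
Qed.

(** Multiplication by [row_base M], whose rows are independent, is an injective linear map with
    image [U]. *)
Lemma dim_rowspace {m p : nat} (U : {vspace 'rV[R]_m}) (M : 'M[R]_(p, m)) :
  (forall u, (u \in U) = (u <= M)%MS) -> \dim U = \rank M.
Proof.
move=> UM; pose f := linfun (mulmxr (row_base M) : 'rV_(\rank M) -> 'rV_m).
have -> : U = limg f.
  apply/vspaceP => u; rewrite UM -(eq_row_base M); apply/submxP/memv_imgP.
    by move=> [D ->]; exists D; rewrite ?memvf // lfunE.
  by move=> [D _ ->]; exists D; rewrite lfunE.
rewrite limg_dim_eq; first by rewrite dimvf dim_matrix mul1r.
apply/eqP; rewrite -subv0; apply/subvP => u.
rewrite memv_cap memvf memv_ker lfunE /= => /eqP u0.
have [B NB] := row_freeP (row_base_free M).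
by rewrite memv0 -(mulmx1 u) -NB mulmxA u0 mul0mx.
Qed.

Context {n m : nat} (x : 'I_n -> 'rV[R]_m).
Implicit Types (A : {set 'I_n}).

Let diffs A i0 : 'M[R]_m := (\sum_(i in A) <<x i - x i0>>)%MS.

(** Subtracting row [i0] turns the other rows into differences with leading entry 0, and row [i0]
    itself accounts for the extra 1. *)
Lemma rk_hom_rows A i0 : i0 \in A -> rk (hom_rows x) A = (\rank (diffs A i0)).+1.
Proof.
move=> i0A.
pose M : 'M[R]_(1 + m) := block_mx 1%:M (x i0) 0 (diffs A i0).
have rowspanM : (rowspan (hom_rows x) A :=: M)%MS.
  apply/eqmxP/andP; split.
    apply/rowspan_sub => i iA; rewrite row_hom_rows.
    have -> : row_mx 1 (x i) = row_mx 1%:M (x i0) + (x i - x i0) *m row_mx 0 1%:M :> 'rV[R]_(1 + m).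
      by rewrite mul_mx_row mulmx0 mulmx1 add_row_mx addr0 addrC subrK.
    rewrite /M block_mxEv -addsmxE addmx_sub_adds //.
    have -> : row_mx 0 (diffs A i0) = diffs A i0 *m row_mx 0 1%:M :> 'M[R]_(m, 1 + m).
      by rewrite mul_mx_row mulmx0 mulmx1.
    by apply/submxMr/(sumsmx_sup i) => //; rewrite genmxE.
  rewrite /M block_mxEv -addsmxE addsmx_sub -[row_mx 1%:M _]row_hom_rows row_sub_rowspan //=.
  have -> : row_mx 0 (diffs A i0) = diffs A i0 *m row_mx 0 1%:M :> 'M[R]_(m, 1 + m).
    by rewrite mul_mx_row mulmx0 mulmx1.
  rewrite sumsmxMr_gen; apply/sumsmx_subP => i iA.
  rewrite genmxE; apply: submx_trans (_ : <<x i - x i0>> *m _ <= (x i - x i0) *m row_mx 0 1%:M)%MS _.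
    by apply: submxMr; rewrite genmxE.
  have -> : (x i - x i0) *m row_mx 0 1%:M = row i (hom_rows x) - row i0 (hom_rows x).
    by rewrite !row_hom_rows mul_mx_row mulmx0 mulmx1 opp_row_mx add_row_mx subrr.
  by rewrite addmx_sub ?eqmx_opp ?row_sub_rowspan.
rewrite /rk rowspanM.
have -> : M = block_mx 1%:M 0 0 (diffs A i0) *m block_mx 1%:M (x i0) 0 1%:M.
  by rewrite mulmx_block !(mul1mx, mulmx1, mulmx0, mul0mx, addr0, add0r).
rewrite mxrankMfree ?rank_diag_block_mx ?mxrank1 //.
by rewrite row_free_unit unitmxE det_ublock !det1 mulr1 unitr1.
Qed.

Lemma has_dim_hull A i0 : i0 \in A -> has_dim (hull x A) (rk (hom_rows x) A).-1.
Proof.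
move=> i0A; rewrite (rk_hom_rows i0A) /=.
pose U : {vspace 'rV[R]_m} := (\sum_(i in A) <[x i - x i0]>)%VS.
exists (x i0), U; split.
  apply: dim_rowspace => u; apply/idP/idP.
    move=> /memv_sumP[v vA ->]; apply: summx_sub_sums => i iA.
    by have /vlineP[k ->] := vA i iA; rewrite genmxE scalemx_sub.
  move=> /sub_sums_genmxP[c ->]; apply: memv_suml => i iA.
  by rewrite [c i]mx11_scalar mul_scalar_mx memvZ // (subvP (sumv_sup i iA (subvv _))) // memv_line.
apply/seteqP; split.
  apply: smallest_sub => [y z t /= yU zU|_ [l [l0 lA l1] ->] /=].
    have -> : t *: y + (1 - t) *: z - x i0 = t *: (y - x i0) + (1 - t) *: (z - x i0).
      by apply/rowP => j; rewrite !mxE; ring.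
    by rewrite memvD ?memvZ.
  rewrite -[x i0]scale1r -l1 scaler_suml -sumrB; apply: memv_suml => i _.
  have [iA|/lA->] := boolP (i \in A); last by rewrite !scale0r subrr mem0v.
  by rewrite -scalerBr memvZ // (subvP (sumv_sup i iA (subvv _))) // memv_line.
move=> y /= /memv_sumP[v vA yv] S [/= affS xS].
have SA i : i \in A -> S (x i) by move=> /(hull_mem x)/xS.
(* It suffices that [S] is stable under translation by each generator of [U]. *)
have : forall z, S z -> S (z + (y - x i0)); last first.
  by move=> /(_ _ (SA _ i0A)); rewrite addrCA subrr addr0.
rewrite {}yv; elim/big_ind: _ => [z|u w Su Sw z Sz|i iA z Sz]; first by rewrite addr0.
  by rewrite addrA; apply/Sw/Su.
have /vlineP[k ->] := vA i iA.
(* Take the midpoint of [z] and [x i], then extrapolate away from [x i0] with coefficient 2. *)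
have Si : S (z + (x i - x i0)).
  have := affS _ _ 2 (affS _ _ 2^-1 Sz (SA i iA)) (SA _ i0A); congr S.
  by apply/rowP => j; rewrite !mxE; field.
have := affS _ _ k Si Sz; congr S.
by apply/rowP => j; rewrite !mxE; ring.
Qed.

End Dimension.

(** * Faces of a polytope *)

Section AffineForm.
Context {R : realType} {n m : nat}.
Variable x : 'I_n -> 'rV[R]_m.
Implicit Types (A : {set 'I_n}) (c : 'cV[R]_(1 + m)) (l : 'I_n -> R).

Definition aff c (y : 'rV[R]_m) : R := c 0 0 + (y *m dsubmx c) 0 0.

Lemma aff_height c i : aff c (x i) = height (hom_rows x) c i.
Proof. by rewrite height_hom_rows. Qed.

(** The constant form 1 exposes the empty face, and adding multiples of it shifts all heights
    equally. *)
Lemma height_const i : height (hom_rows x) (delta_mx 0 0) i = 1.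
Proof.
rewrite height_hom_rows; have -> : dsubmx (delta_mx 0 0 : 'cV[R]_(1 + m)) = 0.
  by apply/colP => j; rewrite !mxE; case: eqP => // /(congr1 val).
by rewrite mulmx0 !mxE addr0.
Qed.

Lemma aff_weights A c l : weights A l ->
  aff c (\sum_i l i *: x i) = \sum_i l i * aff c (x i).
Proof.
move=> [_ _ l1]; rewrite /aff mulmx_suml summxE -[X in X + _ = _]mul1r -[X in X * _ + _ = _]l1 mulr_suml -big_split.
by apply: eq_bigr => i _ /=; rewrite mulrDr -scalemxAl; congr (_ + _); rewrite mxE.
Qed.

Lemma aff_hull_ge0 A c y : (forall i, i \in A -> 0 <= aff c (x i)) -> hull x A y ->
  0 <= aff c y.
Proof.
move=> cA [l lA ->]; rewrite (aff_weights c lA); apply: sumr_ge0 => i _.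
have [l0 l_out _] := lA; have [iA|/l_out->] := boolP (i \in A).
  by rewrite mulr_ge0 ?cA.
by rewrite mul0r.
Qed.

(** A form nonnegative at all the points vanishes at a convex combination only if it vanishes at
    every point of positive weight. *)
Lemma hull_exposes A c : exposes (hom_rows x) c A ->
  hull x A = hull x finset.setT `&` [set y | aff c y = 0].
Proof.
move=> [c0 cA]; apply/seteqP; split=> [y [l lA ->]|y [[l lT ->]] /= cy].
  split; first by exists l => //; apply: weightsS lA; exact: finset.subsetT.
  rewrite /= (aff_weights c lA); apply: big1 => i _.
  have [_ l_out _] := lA; have [|/l_out->] := boolP (i \in A); last by rewrite mul0r.
  by rewrite cA aff_height => /eqP->; rewrite mulr0.
have [l0 _ l1] := lT; exists l => //; split=> // i; rewrite cA => ci.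
move: cy; rewrite (aff_weights c lT) => /eqP; rewrite psumr_eq0.
  by move=> /allP/(_ i (mem_index_enum _)) /=; rewrite mulf_eq0 aff_height (negbTE ci) orbF => /eqP.
by move=> j _; rewrite aff_height mulr_ge0.
Qed.

Lemma hull_nonempty A y : hull x A y -> exists i, i \in A.
Proof.
move=> [l [l0 lA l1] _]; apply/set0Pn/negP => /eqP A0.
move: l1; rewrite big1 ?(eq_sym 0) => [|i _]; last by rewrite lA // A0 inE.
by move/eqP; rewrite eq_sym oner_eq0.
Qed.

End AffineForm.

Lemma finset_card_le {T : finType} {U : Type} (S : {set T}) (B : set U) (f : T -> U) (N : nat) :
  (forall s, s \in S -> B (f s)) -> {in S &, injective f} ->
  (B #<= `I_N)%card -> (#|S| <= N)%N.
Proof.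
move=> fB finj BN; rewrite -card_le_II; apply: card_le_trans BN.
have [->|[s0 _]] := set_0Vmem S; first by rewrite cards0 II0; exact: card_ge0.
pose g k := f (nth s0 (enum S) k).
have gS k : (k < #|S|)%N -> nth s0 (enum S) k \in S.
  by move=> kS; rewrite -mem_enum mem_nth // -cardE.
have ginj : {in `I_#|S| &, injective g}.
  move=> i j /set_mem /= iS /set_mem /= jS /finj; rewrite !gS // => /(_ isT isT)/eqP.
  by rewrite nth_uniq -?cardE ?enum_uniq // => /eqP.
rewrite -(card_le_eql (inj_card_eq ginj)); apply: subset_card_le.
by move=> _ [k kS <-]; apply/fB/gS.
Qed.

Section Faces.
Context {R : realType}.
Variables (P : polytope R) (n : nat) (x : 'I_n -> 'rV[R]_(ambient P)).
Hypothesis bodyE : body P = hull x finset.setT.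
Implicit Types (A B : {set 'I_n}) (F G : set 'rV[R]_(ambient P)).

Definition vset F : {set 'I_n} := [set i | `[< F (x i) >]].

Lemma vsetP F i : reflect (F (x i)) (i \in vset F).
Proof. by rewrite inE; exact: asboolP. Qed.

Lemma vsetS F G : F `<=` G -> vset F \subset vset G.
Proof. by move=> FG; apply/fintype.subsetP => i /vsetP/FG/vsetP. Qed.

Lemma hullS A B : A \subset B -> hull x A `<=` hull x B.
Proof. by move=> AB y [l lA ->]; exists l => //; exact: weightsS lA. Qed.

Lemma face_exposes F : faces P F -> exists2 c, exposes (hom_rows x) c (vset F) &
  F = hull x (vset F).
Proof.
(* The column [c] encodes the slack [b - y *m c0], which is nonnegative on the body and zero exactly
   on the face. *)
move=> [c0 [b [leb FE]]]; pose c : 'cV[R]_(1 + ambient P) := col_mx b%:M (- c0).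
have cE y : aff c y = b - (y *m c0) 0 0.
  rewrite /aff col_mxKd mulmxN [X in _ + X]mxE; congr (_ + _).
  have -> : (0 : 'I_(1 + ambient P)) = lshift (ambient P) 0 by apply/val_inj.
  by rewrite col_mxEu mxE eqxx.
have xbody i : body P (x i) by rewrite bodyE; apply: hull_mem; rewrite inE.
have expo : exposes (hom_rows x) c (vset F).
  split=> i; rewrite -aff_height cE; first by rewrite subr_ge0 leb.
  by apply/vsetP/eqP; rewrite FE; [move=> [_ /= ->]; rewrite subrr | move/subr0_eq ->].
exists c => //; rewrite (hull_exposes expo) -bodyE {1}FE; congr (_ `&` _).
by apply/seteqP; split=> y /=; rewrite cE; [move->; rewrite subrr | move/subr0_eq->].
Qed.

Lemma face_exposed F : faces P F -> exposed (hom_rows x) (vset F).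
Proof. by move=> /face_exposes[c]; exists c. Qed.

Lemma face_hull F : faces P F -> F = hull x (vset F).
Proof. by move=> /face_exposes[]. Qed.

Lemma exposed_face A : exposed (hom_rows x) A -> faces P (hull x A).
Proof.
move=> [c cA]; exists (- dsubmx c), (c 0 0).
have cE y : (y *m - dsubmx c) 0 0 = c 0 0 - aff c y.
  by rewrite mulmxN mxE /aff opprD addNKr.
split=> [y|].
  rewrite bodyE cE lerBlDr lerDl; apply: aff_hull_ge0 => i _.
  by rewrite aff_height cA.1.
rewrite (hull_exposes cA) -bodyE; congr (_ `&` _).
apply/seteqP; split=> y /=; rewrite cE; first by move->; rewrite subr0.
by move/eqP; rewrite subr_eq addrC -subr_eq subrr => /eqP.
Qed.

Lemma vset_hull A : exposed (hom_rows x) A -> vset (hull x A) = A.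
Proof.
move=> [c cA]; apply/setP => i; apply/vsetP/idP => [|iA]; last exact: hull_mem.
by rewrite (hull_exposes cA) => -[_ /=]; rewrite aff_height (cA.2 i) => ->.
Qed.

Lemma exposed_empty : exposed (hom_rows x) finset.set0.
Proof.
by exists (delta_mx 0 0); split=> i; rewrite height_const ?ler01 // inE oner_eq0.
Qed.

(** A one-point face is the hull of the listed points on it, so it is a listed point. Conversely, a
    form separating [x w] from the other points becomes, after a shift, one that exposes [w]
    alone. *)
Lemma irredundant_vertices : (forall w, ~ hull x [set~ w] (x w)) ->
  vertices P = range x.
Proof.
move=> irr; apply/seteqP; split=> v.
  move=> fv; have : hull x (vset [set v]) v by rewrite -(face_hull fv).
  by move=> /hull_nonempty[i /vsetP xi]; exists i.
move=> [w _ <-]; rewrite /vertices /=.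
have [c c_ge0 cw] := hull_separation (irr w).
suff ew : exposed (hom_rows x) [set w].
  have := exposed_face ew; congr (faces P _); apply/seteqP; split=> [y [l [l0 lw l1] ->]|_ ->].
    move: l1; rewrite (bigD1 w) //= big1 => [|i iw]; last by rewrite lw // inE.
    rewrite addr0 /= (bigD1 w) //= => ->; rewrite scale1r big1 ?addr0 // => i iw.
    by rewrite lw ?scale0r // inE.
  by apply: hull_mem; rewrite inE.
exists (c - height (hom_rows x) c w *: delta_mx 0 0).
have cwE : height (hom_rows x) c w < 0 by rewrite height_hom_rows.
have hE i : height (hom_rows x) (c - height (hom_rows x) c w *: delta_mx 0 0) i =
    height (hom_rows x) c i - height (hom_rows x) c w.
  by rewrite -scaleNr heightDZ height_const mulr1.
have gt i : i != w -> height (hom_rows x) c w < height (hom_rows x) c i.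
  by move=> iw; apply: lt_le_trans cwE _; apply: c_ge0; rewrite !inE.
split=> i; rewrite hE.
  by rewrite subr_ge0; have [->|/gt/ltW] := eqVneq i w.
by rewrite inE subr_eq0; have [->|/gt/gt_eqF->] := eqVneq i w; rewrite ?eqxx.
Qed.

Lemma face_sub F G : faces P F -> faces P G ->
  F `<=` G <-> vset F \subset vset G.
Proof.
move=> fF fG; split; first exact: vsetS.
by move=> FG; rewrite (face_hull fF) (face_hull fG); apply: hullS.
Qed.

Lemma rk_of_dim d : has_dim (body P) d -> rk (hom_rows x) finset.setT = d.+1.
Proof.
move=> hd; have [y] := has_dim_nonempty hd; rewrite bodyE => /hull_nonempty[i iT].
have := has_dim_hull x iT; rewrite -bodyE => /(has_dim_uniq hd) ->.
by rewrite (rk_hom_rows x iT).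
Qed.

Lemma facet_set_facet d A : (1 <= d)%N -> has_dim (body P) d ->
  A \in facet_sets (hom_rows x) -> facets P (hull x A).
Proof.
move=> d1 hd fA; split; first exact/exposed_face/facet_exposed.
move: fA; rewrite inE => /andP[_ /eqP]; rewrite (rk_of_dim hd) => -[rkA].
exists d.-1; rewrite prednK //; split => //.
(* [A] has rank [d], which is positive, so it is nonempty; the empty face would have no
   dimension. *)
have [A0|[i iA]] := set_0Vmem A; first by rewrite A0 rk0 in rkA; rewrite -rkA in d1.
by have := has_dim_hull x iA; rewrite rkA.
Qed.

Lemma card_facet_sets d N : (1 <= d)%N -> has_dim (body P) d ->
  (facets P #<= `I_N)%card -> (#|facet_sets (hom_rows x)| <= N)%N.
Proof.
move=> d1 hd leN; apply: finset_card_le leN => [A fA|A B fA fB AB]; first exact: facet_set_facet d1 hd fA.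
by rewrite -(vset_hull (facet_exposed fA)) AB vset_hull //; exact: facet_exposed.
Qed.

End Faces.

(** In a generating family of least size no point lies in the hull of the others, since it could be
    dropped; so [irredundant_vertices] applies. *)
Lemma body_vertices {R : realType} (P : polytope R) :
  finite_set (vertices P) /\ body P = convex_hull (vertices P).
Proof.
have gen : exists k, `[< exists x : 'I_k -> 'rV[R]_(ambient P),
    body P = hull x finset.setT >].
  have [V /finite_seqP[s ->] bE] := body_hull _ P.
  exists (size s); apply/asboolP; exists (fun i => nth 0 s i).
  rewrite bE -convex_hullE; congr convex_hull; apply/seteqP; split=> y /=.
    by move=> /(nthP 0)[i si <-]; exists (Ordinal si); rewrite //= inE.
  by move=> [i _ <-]; apply: mem_nth.
have [k /asboolP[x bE] kmin] := ex_minnP gen.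
have xV : vertices P = range x.
  apply: irredundant_vertices => // w xw.
  case: k => [|k] in x bE kmin w xw *; first by case: w {xw}.
  suff /kmin : `[< exists x : 'I_k -> 'rV[R]_(ambient P),
    body P = hull x finset.setT >] by rewrite ltnn.
  apply/asboolP; exists (x \o lift w); rewrite bE.
  have -> : hull (x \o lift w) finset.setT = hull x [set~ w].
    rewrite -!convex_hullE; congr convex_hull; apply/seteqP; split=> [_ [i _ <-]|_ [i iw <-]].
      by exists (lift w i) => //=; rewrite !inE eq_sym neq_lift.
    move: iw; rewrite /= !inE eq_sym => /unlift_some[j ij _].
    by exists j; rewrite //= ?inE // -ij.
  apply/seteqP; split; last by apply: hullS; apply: finset.subsetT.
  rewrite -convex_hullE -[X in _ `<=` X]convex_hullE.
  apply: smallest_sub => [|_ [i _ <-]]; first by rewrite convex_hullE; exact: hull_convex.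
  have [->|iw] := eqVneq i w; first by rewrite convex_hullE.
  by rewrite convex_hullE; apply: hull_mem; rewrite !inE.
split.
  by rewrite xV; apply: finite_image; exact: finite_finset.
by rewrite xV bE -convex_hullE; congr convex_hull; apply/seteqP; split=> _ [i _ <-]; exists i => //=; rewrite inE.
Qed.

(** * Combinatorial types *)

Section CombinatorialType.
Context {R : realType}.
Implicit Types P Q : polytope R.

Lemma comb_equiv_trans P Q S : comb_equiv P Q -> comb_equiv Q S -> comb_equiv P S.
Proof.
move=> [f fbij fle] [g gbij gle]; exists (g \o f); first exact: set_bij_comp gbij.
move=> F G fF fG; rewrite fle // gle //; exact: (set_bij_sub fbij).
Qed.

(** A face is determined by the indices of the points on it, so the isomorphism sends [hull x A] to
    [hull y A]. *)
Lemma comb_equiv_exposed P Q (n : nat) (x : 'I_n -> 'rV[R]_(ambient P))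
    (y : 'I_n -> 'rV[R]_(ambient Q)) :
  body P = hull x finset.setT -> body Q = hull y finset.setT ->
  (forall A, exposed (hom_rows x) A <-> exposed (hom_rows y) A) -> comb_equiv P Q.
Proof.
move=> bx hy xy.
have toQ F : faces P F -> exposed (hom_rows y) (vset x F).
  by move=> /(face_exposed bx)/xy.
have toP G : faces Q G -> exposed (hom_rows x) (vset y G).
  by move=> /(face_exposed hy)/xy.
exists (fun F => hull y (vset x F)); first split.
- by move=> F /toQ/(exposed_face hy).
- move=> F G /set_mem fF /set_mem fG FG; rewrite (face_hull bx fF) (face_hull bx fG).
  by rewrite -(vset_hull (toQ F fF)) FG vset_hull //; exact: toQ.
- move=> G fG; exists (hull x (vset y G)); first exact/(exposed_face bx)/toP.
  by rewrite vset_hull ?[RHS](face_hull hy fG) //; exact: toP.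
move=> F G fF fG; rewrite (face_sub bx fF fG).
rewrite (@face_sub _ Q n y hy (hull y _) (hull y _)).
- by rewrite !vset_hull //; apply: toQ.
- exact/(exposed_face hy)/toQ.
- exact/(exposed_face hy)/toQ.
Qed.

Lemma comb_type_exposed P Q (n : nat) (x : 'I_n -> 'rV[R]_(ambient P))
    (y : 'I_n -> 'rV[R]_(ambient Q)) :
  body P = hull x finset.setT -> body Q = hull y finset.setT ->
  (forall A, exposed (hom_rows x) A <-> exposed (hom_rows y) A) ->
  comb_type P = comb_type Q.
Proof.
move=> bx hy xy; apply/seteqP; split=> S; apply: comb_equiv_trans.
  by apply: comb_equiv_exposed hy bx _ => A; rewrite xy.
exact: comb_equiv_exposed bx hy xy.
Qed.

Lemma vertex_enumeration P : exists (n : nat) (x : 'I_n -> 'rV[R]_(ambient P)) (k : nat),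
  [/\ injective x, range x = vertices P, body P = hull x finset.setT
    & forall i : 'I_n, (i < k)%N = ~~ `[< exposed (hom_rows x) [set~ i]%SET >]].
Proof.
have [fV bV] := body_vertices P.
have [s0 /[dup] + ->] := (finite_seqP _).1 fV; move=> sV.
(* Apices are described through points rather than indices because the enumeration itself is sorted
   by this predicate, non-apices first. *)
pose apex (v : 'rV[R]_(ambient P)) :=
  `[< exists F, faces P F /\ forall w, vertices P w -> (F w <-> w <> v) >].
pose s1 := [seq v <- undup s0 | ~~ apex v].
pose s := s1 ++ [seq v <- undup s0 | apex v].
have s_perm : perm_eq s (undup s0) by rewrite /s perm_catC perm_filterC.
have s_uniq : uniq s by rewrite (perm_uniq s_perm) undup_uniq.
have s_mem : s =i s0 by move=> v; rewrite (perm_mem s_perm) mem_undup.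
pose x (i : 'I_(size s)) := nth 0 s i.
have x_inj : injective x.
  by move=> i j /eqP; rewrite nth_uniq // => /eqP/val_inj.
have x_range : range x = [set` s0].
  apply/seteqP; split=> [_ [i _ <-] /=|v /=]; first by rewrite -s_mem mem_nth.
  by rewrite -s_mem => /(nthP 0)[i si <-]; exists (Ordinal si).
have bx : body P = hull x finset.setT.
  rewrite bV sV -x_range -convex_hullE; congr convex_hull.
  by apply/seteqP; split=> _ [i _ <-]; exists i => //=; rewrite inE.
exists (size s), x, (size s1); split=> // i.
have xiV j : vertices P (x j) by rewrite sV -x_range; exists j.
have -> : `[< exposed (hom_rows x) [set~ i]%SET >] = apex (x i).
  apply/asboolP/asboolP => [e|[F [fF Fv]]].
    exists (hull x [set~ i]); split; first exact: (exposed_face bx).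
    move=> w; rewrite sV -x_range => -[j _ <-].
    rewrite (rwP (vsetP x _ _)) (vset_hull e) !inE.
    by split; [move/eqP => ij /x_inj | move=> ij; apply/eqP => ji; apply: ij; rewrite ji].
  have := face_exposed bx fF; congr exposed; apply/setP => j; rewrite !inE.
  apply/asboolP/(negPP eqP) => [/(Fv _ (xiV j)) ij ji|ij]; first by apply: ij; rewrite ji.
  by apply/Fv => // /x_inj.
rewrite /x /s nth_cat; case: ltnP => si.
  by have := mem_nth 0 si; rewrite mem_filter => /andP[].
have : (i - size s1 < size [seq v <- undup s0 | apex v])%N.
  by rewrite ltn_subLR // -size_cat.
by move/(mem_nth 0); rewrite mem_filter => /andP[->].
Qed.

Definition core_bound (a b : nat) : nat :=
  let D := (b.+1 * a.+1)%N in (a * D * D * D * D)%N.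

Lemma core_presentation P (a b d : nat) : (1 <= d)%N -> has_dim (body P) d ->
  (vertices P #<= `I_(d + 1 + a))%card -> (facets P #<= `I_(d + 1 + b))%card ->
  exists (n : nat) (x : 'I_n -> 'rV[R]_(ambient P)),
    [/\ body P = hull x finset.setT, (d.+1 <= n <= d.+1 + a)%N
      & forall i : 'I_n, (core_bound a b <= i)%N ->
          exposed (hom_rows x) [set~ i]%SET].
Proof.
move=> d1 hd nV nF; have [n [x [k [x_inj x_range bx kP]]]] := vertex_enumeration P.
rewrite addn1 in nV nF; have rkX := rk_of_dim bx hd.
have nle : (n <= d.+1 + a)%N.
  rewrite -[n]card_ord -cardsT; apply: (@finset_card_le _ _ _ _ x) nV => [i _|i j _ _ /x_inj//].
  by rewrite -x_range; exists i.
exists n, x; split=> //.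
  by rewrite nle -rkX (leq_trans (rk_card _ _)) // cardsT card_ord.
have e1 i : exposed (hom_rows x) [set i]%SET.
  have : vertices P (x i) by rewrite -x_range; exists i.
  move/(face_exposed bx); congr exposed; apply/setP => j; rewrite !inE.
  by apply/asboolP/eqP => [/x_inj|->].
have := @card_non_apex _ _ _ (hom_rows x) a b (exposed_empty x) e1.
rewrite rkX => /(_ nle (card_facet_sets bx d1 hd nF)).
set U := [set v | _]%SET => cardU i; apply: contraPP => /asboolPn; rewrite -kP => ik.
apply/negP; rewrite -ltnNge; apply: leq_trans cardU.
(* Non-apices come first, so a non-apex [i] makes all [i.+1] indices up to [i] members of [U]. *)
pose g (j : 'I_i.+1) : 'I_n := widen_ord (ltn_ord i) j.
have g_inj : injective g by move=> j j' /(congr1 val)/= /val_inj.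
rewrite -[i.+1]card_ord -(card_imset predT g_inj); apply/subset_leq_card.
apply/fintype.subsetP => _ /imsetP[j _ ->]; rewrite inE -kP /=.
exact: leq_ltn_trans (ltn_ord j : (j <= i)%N) ik.
Qed.

(** Indices from [C] on will be apices, so including all of them loses nothing by
    [exposed_setU_apices]. Values are compared because neither of [C] and [n] bounds the other. *)
Definition lift_core (C n : nat) (B : {set 'I_C}) : {set 'I_n} :=
  [set i : 'I_n | (C <= i)%N || [exists j in B, val j == val i]]%SET.

(** The traces of faces on the first [C] indices, stored in a finite type that depends on neither
    [n] nor the dimension. *)
Definition core_family (C : nat) {n m : nat} (x : 'I_n -> 'rV[R]_m) : {set {set 'I_C}} :=
  [set B | `[< exposed (hom_rows x) (lift_core n B) >]]%SET.

Lemma core_family_exposed (C n m m' : nat) (x : 'I_n -> 'rV[R]_m) (y : 'I_n -> 'rV[R]_m') :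
  (forall i : 'I_n, (C <= i)%N -> exposed (hom_rows x) [set~ i]%SET) ->
  (forall i : 'I_n, (C <= i)%N -> exposed (hom_rows y) [set~ i]%SET) ->
  core_family C x = core_family C y ->
  forall A, exposed (hom_rows x) A <-> exposed (hom_rows y) A.
Proof.
move=> ex ey xy A; pose T := [set i : 'I_n | (C <= i)%N]%SET.
pose B := [set j : 'I_C | [exists i in A, val j == val i]]%SET.
have liftB : A :|: T = lift_core n B.
  apply/setP => i; rewrite !inE orbC; case: leqP => //= iC.
  apply/idP/existsP => [iA|[j]].
    exists (Ordinal iC); rewrite inE eqxx andbT.
    by apply/existsP; exists i; rewrite iA /=.
  rewrite inE => /andP[/existsP[k /andP[kA /eqP jk]] /eqP ji].
  by rewrite (_ : i = k) //; exact/val_inj/(etrans (esym ji)).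
have eT m0 (z : 'I_n -> 'rV[R]_m0) :
    (forall i : 'I_n, (C <= i)%N -> exposed (hom_rows z) [set~ i]%SET) ->
    exposed (hom_rows z) A <-> B \in core_family C z.
  move=> ez; rewrite inE -(rwP (asboolP _)) -liftB exposed_setU_apices //.
  by move=> i; rewrite inE; exact: ez.
by rewrite (eT _ x ex) (eT _ y ey) xy.
Qed.

End CombinatorialType.

(* Counting the combinatorial types *)
Local Close Scope ring_scope.
Local Open Scope card_scope.

Theorem theorem1 (R : realType) (alpha beta : nat) :
  exists K : nat, forall d : nat, (1 <= d)%N ->
    [set comb_type P | P in
       [set P : polytope R | [/\ has_dim (body P) d,
          vertices P #<= `I_(d + 1 + alpha) &
          facets P #<= `I_(d + 1 + beta)]]] #<= `I_K.
Proof.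
(* A signature records the excess of the number of vertices over [d.+1] and the core family; [T]
   does not involve [d]. *)
pose C := core_bound alpha beta; pose T : finType := ('I_alpha.+1 * {set {set 'I_C}})%type.
exists #|T| => d d1; set class := [set P | _].
(* A relation, since the enumeration of the vertices is a choice; a shared signature still forces
   equal types. *)
pose sig (P : polytope R) (t : T) := exists x : 'I_(d.+1 + t.1) -> 'rV[R]_(ambient P),
  [/\ body P = hull x finset.setT, core_family C x = t.2
    & forall i, (C <= val i)%N -> exposed (hom_rows x) [set~ i]%SET].
have sigP P : class P -> exists t, sig P t.
  move=> [hd nV nF]; have [n [x [bx /andP[dn nd] ex]]] := core_presentation d1 hd nV nF.
  have na : (n - d.+1 < alpha.+1)%N by rewrite ltnS leq_subLR.
  have nE : n = (d.+1 + Ordinal na)%N by rewrite /= subnKC.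
  move: (Ordinal na) nE => r nE; subst n.
  by exists (r, core_family C x), x.
have sig_type P Q t : sig P t -> sig Q t -> comb_type P = comb_type Q.
  move=> [x [bx xt ex]] [y [hy yt ey]]; apply: comb_type_exposed bx hy _.
  by apply: core_family_exposed ex ey _; rewrite xt yt.
(* Taking the union of all types with signature [t] avoids choosing a representative; by [gE] it is
   a single type whenever [t] occurs in the class. *)
pose g (t : T) : set (polytope R) :=
  [set Q | exists P, [/\ class P, sig P t & comb_type P Q]].
have gE P t : class P -> sig P t -> g t = comb_type P.
  move=> cP sP; apply/seteqP; split=> [Q [P' [_ sP' PQ]]|Q PQ]; last by exists P.
  by rewrite (sig_type _ _ _ sP sP').
have rank_inj : {in [set: T] &, injective (fun t => val (enum_rank t))}.
  by move=> s t _ _ /val_inj/enum_rank_inj.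
apply: (@card_le_trans _ _ _ (g @` [set: T])).
  apply: subset_card_le => _ [P cP <-]; have [t sP] := sigP P cP.
  by exists t => //; rewrite (gE P).
apply: card_le_trans (card_image_le _ _) _.
rewrite -(card_le_eql (inj_card_eq rank_inj)); apply: subset_card_le.
by move=> _ [t _ <-] /=.
Qed.
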